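(* Suppose there exist an $\mathrm{SCCD}(v,k,b)$ on point set $X$ with excess $e$ and an $\mathrm{SCCD}(v',k,b')$ on point set $X'$ with excess $e'$, each having an outer expansion set that contains both its $U_0$ and its $U_b$ (resp. $U'_0$ and $U'_{b'}$), where $|X\cap X'|=k-1$. Then, with $v^*=v+v'-k+1$, $b^*=b+b'+\frac{(v'-k+1)(v-k+1)}{k-1}$ and $X^*=X\cup X'$, there exists an $\mathrm{SCCD}(v^*,k,b^* )$ on $X^*$ with excess $e^*=e+e'$ and a disjoint-capable outer expansion set.
   Context: An $\mathrm{SCCD}(v,k,b)$ (linear single change covering design) is a $v$-set $X$ with an ordered list $(B_1,\dots,B_b)$ of $k$-subsets of $X$ with $|B_i\cap B_{i+1}|=k-1$ for $1\le i<b$, such that every pair of elements of $X$ is contained in some block. Its excess is $e=(k-1)b+\binom{k-1}{2}-\binom{v}{2}$. The unchanged subsets are $U_i=B_i\cap B_{i+1}$ for $1\le i\le b-1$; in addition $U_0$ may be any $(k-1)$-subset of $B_1$ and $U_b$ any $(k-1)$-subset of $B_b$. An expansion set is a collection of $\frac{v}{k-1}$ unchanged subsets (distinct indices in $\{0,\dots,b\}$) that are pairwise disjoint with union $X$; it is outer if it contains $U_0$ or $U_b$. An expansion set is disjoint-capable if (1) it contains $U_0$ and $U_b$; (2) $U_0=U_1=U_2=\cdots=U_{k-1}$; and (3) $U_b=\bigcup_{i=1}^{k-1}(B_i\setminus B_{i+1})$. *)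

(* Defs.v *)
From mathcomp Require Import all_boot all_order all_algebra.
Set Implicit Arguments.
Unset Strict Implicit.
Unset Printing Implicit Defensive.

(* The list B = (B_1, ..., B_b) is a sequence numbered from 1: [block B i] is
   B_i when 1 <= i <= size B; every other index is only a junk value. *)
Definition block (T : finType) (B : seq {set T}) (i : nat) : {set T} :=
  nth set0 B i.-1.

Definition is_sccd (T : finType) (X : {set T}) (v k b : nat)
    (B : seq {set T}) : Prop :=
  [/\ #|X| = v,
      size B = b,
      forall A, A \in B -> A \subset X /\ #|A| = k,
      forall i, 0 < i < b -> #|block B i :&: block B i.+1| = k.-1
    & forall x y, x \in X -> y \in X -> x != y ->
        exists2 A, A \in B & (x \in A) && (y \in A)].

(* Integer-valued, so that the subtraction is not truncated. *)
Definition excess (v k b : nat) : int :=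
  ((k.-1 * b + 'C(k.-1, 2))%N%:Z - 'C(v, 2)%:Z)%R.

(* U_0 and U_b are not determined by B, so the whole family U_0, ..., U_b is
   carried as data; the values of U beyond b are irrelevant. *)
Definition unchanged_subsets (T : finType) (k b : nat) (B : seq {set T})
    (U : nat -> {set T}) : Prop :=
  [/\ forall i, 0 < i < b -> U i = block B i :&: block B i.+1,
      U 0 \subset block B 1 /\ #|U 0| = k.-1
    & U b \subset block B b /\ #|U b| = k.-1].

(* The collection is given by its set J of (distinct) indices in {0, ..., b};
   it contains U_0, resp. U_b, when ord0, resp. ord_max, belongs to J. *)
Definition is_expansion_set (T : finType) (X : {set T}) (v k b : nat)
    (B : seq {set T}) (U : nat -> {set T}) (J : {set 'I_b.+1}) : Prop :=
  [/\ unchanged_subsets k b B U,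
      k.-1 %| v /\ #|J| = v %/ k.-1,
      forall i j, i \in J -> j \in J -> i != j -> [disjoint U i & U j]
    & \bigcup_(i in J) U i = X].

Definition is_outer (b : nat) (J : {set 'I_b.+1}) : Prop :=
  ord0 \in J \/ ord_max \in J.

(* [k <= b] guarantees that the blocks B_1, ..., B_k mentioned in the last
   condition exist. *)
Definition disjoint_capable (T : finType) (k b : nat)
    (B : seq {set T}) (U : nat -> {set T}) (J : {set 'I_b.+1}) : Prop :=
  [/\ k <= b,
      ord0 \in J /\ ord_max \in J,
      forall i, i <= k.-1 -> U i = U 0
    & U b = \bigcup_(1 <= i < k) (block B i :\: block B i.+1)].

(* Main.v *)
Require Import Defs.
From mathcomp Require Import all_boot all_order all_algebra.
From mathcomp Require Import perm zify.
Set Implicit Arguments.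
Unset Strict Implicit.
Unset Printing Implicit Defensive.

(* Relabelling points by permutations of X and X', we may assume that
   S = X :&: X' is the last unchanged subset U_b of the first design and the
   first unchanged subset U'_0 of the second.  The two lists of blocks can then
   be concatenated, S becoming the unchanged subset at the junction.  The pairs
   {x, y} with x in X \ S and y in X' \ S are still uncovered: for each A <> S
   in the first expansion set and each such y, insert the block y |: A at a
   place where the unchanged subset is A, which leaves all other unchanged
   subsets in place.  Inserting at the very front, in a row, the blocks y |: U_0
   with y in the last unchanged subset U'_b' makes the first k unchanged subsets
   equal and the first k - 1 discarded points exactly U'_b'. *)

(** * Walks: block lists with their unchanged subsets, and insertion of blocks *)

Section Walks.
Variables (T : finType) (k : nat).
Implicit Types (X A D S V : {set T}) (w : seq ({set T} * {set T})).
Implicit Types (P : {set {set T}}).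

(* A pair [(B_i, U_i)] of a walk is a block with the unchanged subset that
   follows it; [U_0] is represented by the fictitious pair [(set0, U_0)]. *)
Definition step_wf (p : {set T} * {set T}) :=
  [&& #|p.1| == k, #|p.2| == k.-1 & p.2 \subset p.1].

(** Two distinct [k]-sets that share a set of [k.-1] points meet in exactly that set, so inequality
    of consecutive blocks can replace the condition on the size of their intersection. The
    fictitious first block [set0] differs from every [k]-set when [k > 0]; its link only asks that
    [V] lie in the first block. *)
Definition link (p q : {set T} * {set T}) :=
  (p.2 \subset q.1) && (p.1 != q.1).

Definition walk V w :=
  [&& #|V| == k.-1, all step_wf w & path link (set0, V) w].

Definition blocks w := [seq p.1 | p <- w].
Definition links V w := V :: [seq p.2 | p <- w].
Definition last_link V w := last V [seq p.2 | p <- w].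

(** The index set of an expansion set is replaced by the partition [P] of [X] into its members,
    which is stable under insertions that shift indices. [exp_neq] retains that the two ends of the
    walk contribute different classes. *)
Record expandable X w V P : Prop := Expandable {
  exp_walk : walk V w;
  exp_sub : forall D, D \in blocks w -> D \subset X;
  exp_cover : forall x y, x \in X -> y \in X -> x != y ->
    exists2 D, D \in blocks w & (x \in D) && (y \in D);
  exp_part : partition P X;
  exp_links : {subset P <= links V w};
  exp_first : V \in P;
  exp_last : last_link V w \in P;
  exp_neq : V != last_link V w }.

Lemma last_linkE V w : last_link V w = (last (set0, V) w).2.
Proof. by rewrite /last_link -(last_map snd). Qed.

Lemma linksE V w : links V w = [seq p.2 | p <- (set0, V) :: w].
Proof. by []. Qed.

Lemma walk_card V w A : walk V w -> A \in links V w -> #|A| = k.-1.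
Proof.
case/and3P=> /eqP cV /allP wfw _; rewrite inE => /predU1P[-> //|].
by case/mapP=> p /wfw /and3P[_ /eqP cp _] ->.
Qed.

(** The pair [(D, A)] goes right after an entry whose unchanged subset is [A]: then [A] stands both
    before and after [D], and all other links are kept. Since [D] is not yet a block, it differs
    from both neighbours. *)
Lemma walk_insert V w A D : 1 < k ->
    walk V w -> A \in links V w -> A \subset D -> #|D| = k ->
    D \notin blocks w ->
  exists w', [/\ walk V w', perm_eq (blocks w') (D :: blocks w),
    {subset links V w <= links V w'} & last_link V w' = last_link V w].
Proof.
move=> k1 wkw Aw AD cD Dw; have cA := walk_card wkw Aw.
case/and3P: (wkw) => cV wfw pw.
have D0 : set0 != D by apply: contraTneq k1 => D0; rewrite -cD -D0 cards0.
move: Aw; rewrite linksE => /mapP[p pw0 pA].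
case/splitPl: pw0 wfw pw Dw wkw => w1 w2 lp.
rewrite all_cat cat_path lp => /andP[wf1 wf2] /andP[p1 p2].
rewrite /blocks map_cat mem_cat negb_or => /andP[D1 D2] wkw.
exists (w1 ++ (D, A) :: w2); split.
- rewrite /walk cV all_cat wf1 /= wf2 cat_path p1 lp /= {1}/step_wf /= cD cA.
  rewrite !eqxx AD /link /= -pA AD /=; apply/andP; split.
    have := mem_last (set0, V) w1; rewrite lp inE.
    case/predU1P=> [-> //|/(map_f fst) pw1].
    by apply: contraNneq D1 => <-.
  case: w2 p2 D2 {wf2 wkw} => //= q w2 /andP[/andP[Aq _] ->].
  by rewrite inE negb_or pA /link /= Aq => /andP[-> _].
- by rewrite map_cat /= perm_catC /= perm_cons perm_catC.
- move=> C; rewrite !linksE /= !map_cat /= !inE !mem_cat inE.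
  by case/or3P=> ->; rewrite ?orbT.
- rewrite !last_linkE !last_cat /= lp.
  by case: w2 {wf2 p2 D2 wkw} => //=.
Qed.

Lemma walk_inserts V w (Ds : seq {set T}) : 1 < k ->
    walk V w -> uniq Ds -> {in Ds, forall D, D \notin blocks w} ->
    {in Ds, forall D, #|D| = k /\ exists2 A, A \in links V w & A \subset D} ->
  exists w', [/\ walk V w', perm_eq (blocks w') (Ds ++ blocks w),
    {subset links V w <= links V w'} & last_link V w' = last_link V w].
Proof.
move=> k1 wkw; elim: Ds => [|D Ds IH] /=.
  by move=> _ _ _; exists w; split.
case/andP=> DDs uDs Dw AD.
have [||w1 [wk1 pe1 s1 l1]] := IH uDs.
- by move=> C CDs; apply: Dw; rewrite inE CDs orbT.
- by move=> C CDs; apply: AD; rewrite inE CDs orbT.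
have [cD [A Aw sAD]] := AD D (mem_head _ _).
have [|w2 [wk2 pe2 s2 l2]] := walk_insert k1 wk1 (s1 _ Aw) sAD cD.
  by rewrite (perm_mem pe1) mem_cat negb_or DDs Dw ?mem_head.
exists w2; split=> //; last by rewrite l2.
  by rewrite (perm_trans pe2) // perm_cons.
by move=> C /s1/s2.
Qed.

(** Here the position of the new blocks is prescribed: disjoint capability needs them in a row at
    the very front, which [walk_inserts] does not guarantee. *)
Lemma walk_prefix V w (Ds : seq {set T}) : 1 < k ->
    walk V w -> uniq Ds -> {in Ds, forall D, D \notin blocks w} ->
    {in Ds, forall D, #|D| = k /\ V \subset D} ->
  walk V ([seq (D, V) | D <- Ds] ++ w).
Proof.
move=> k1 wkw; elim: Ds => [//|D Ds IH] /= /andP[DDs uDs] Dw VD.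
have /and3P[cV wf1 p1] : walk V ([seq (D, V) | D <- Ds] ++ w).
  apply: IH => // C CDs; first by apply: Dw; rewrite inE CDs orbT.
  by apply: VD; rewrite inE CDs orbT.
have [cD sVD] := VD D (mem_head _ _).
have DN : D \notin blocks ([seq (D, V) | D <- Ds] ++ w).
  rewrite /blocks map_cat -map_comp map_id_in // mem_cat negb_or DDs.
  exact: Dw (mem_head _ _).
rewrite /walk cV /= wf1 {1}/step_wf {1}/link /= cD sVD (eqP cV) !eqxx /=.
apply/andP; split.
  by apply: contraTneq k1 => D0; rewrite -cD -D0 cards0.
case: (_ ++ w) p1 DN => //= q w1 /andP[/andP[Vq _] ->].
by rewrite inE negb_or /link /= Vq => /andP[-> _].
Qed.

Lemma walk_nthE V w i : i < size w ->
  [/\ block (blocks w) i.+1 = (nth (set0, V) w i).1,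
      nth set0 (links V w) i.+1 = (nth (set0, V) w i).2
    & nth set0 (links V w) i = (nth (set0, V) ((set0, V) :: w) i).2].
Proof.
move=> iw; split; first by rewrite /block (nth_map (set0, V)).
  by rewrite /= (nth_map (set0, V)).
by rewrite linksE (nth_map (set0, V)) //= ltnS ltnW.
Qed.

Lemma walk_meet V w i : walk V w -> 0 < i < size w ->
  [/\ #|block (blocks w) i :&: block (blocks w) i.+1| = k.-1
    & nth set0 (links V w) i = block (blocks w) i :&: block (blocks w) i.+1].
Proof.
case: i => [//|i] /and3P[cV /allP wfw /(pathP (set0, V)) pw] iw.
have {}iw : i.+1 < size w by [].
have [b1 l1 _] := walk_nthE V (ltnW iw); have [b2 _ _] := walk_nthE V iw.
rewrite l1 b1 b2.
have /andP[/= l12 n12] := pw _ iw.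
have /and3P[/eqP c1 /eqP c1' s1] := wfw _ (mem_nth (set0, V) (ltnW iw)).
have /and3P[/eqP c2 _ _] := wfw _ (mem_nth (set0, V) iw).
set D1 := (nth _ w i).1 in b1 n12 c1 s1 *.
set D2 := (nth _ w i.+1).1 in b2 n12 c2 l12 *.
set U := (nth _ w i).2 in l1 l12 c1' s1 *.
have sU : U \subset D1 :&: D2 by rewrite subsetI s1.
have cI : #|D1 :&: D2| <= k.-1.
  suff : #|D1 :&: D2| < k by lia.
  rewrite ltnNge; apply: contraNN n12 => kI.
  have e1 : D1 :&: D2 = D1 by apply/eqP; rewrite eqEcard subsetIl c1.
  have e2 : D1 :&: D2 = D2 by apply/eqP; rewrite eqEcard subsetIr c2.
  by rewrite -{1}e1 e2.
have e : U = D1 :&: D2 by apply/eqP; rewrite eqEcard sU c1'.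
by rewrite -e.
Qed.

End Walks.

Arguments links {T} V w.
Arguments last_link {T} V w.

(** * Passing between designs with expansion sets and walks *)

Lemma unchanged_subsetsP (T : finType) (X : {set T}) (v k b : nat)
    (B : seq {set T}) (U : nat -> {set T}) i : 1 < k ->
    is_sccd X v k b B -> unchanged_subsets k b B U -> i <= b ->
  [/\ 0 < b, #|U i| = k.-1, 0 < i -> U i \subset block B i
    & i < b -> U i \subset block B i.+1].
Proof.
move=> k1 [_ sB _ hB _] [Um [sU0 cU0] [sUb cUb]] ib.
(* In an empty list [block B 1] is the default value [set0], which would force [U 0] to be empty
   although [k.-1 > 0]. *)
have b0 : 0 < b.
  rewrite lt0n; apply: contraTneq k1 => b0; rewrite b0 in sB.
  move: sU0 cU0; rewrite (size0nil sB) /block nth_nil subset0 => /eqP->.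
  by rewrite cards0; lia.
have [->|i0] := posnP i; first by rewrite b0.
have [ib'|bi] := ltnP i b; last by have -> : i = b by lia.
by rewrite Um ?hB ?i0 // subsetIl subsetIr.
Qed.

Lemma expandable_of_sccd (T : finType) (X : {set T}) (v k b : nat)
    (B : seq {set T}) (U : nat -> {set T}) (J : {set 'I_b.+1}) : 1 < k ->
    is_sccd X v k b B -> is_expansion_set X v k B U J ->
    ord0 \in J -> ord_max \in J ->
  exists w V P, expandable k X w V P /\ size w = b.
Proof.
move=> k1 hB [hU _ dJ cJ] J0 Jm.
have UP i ib := unchanged_subsetsP (i := i) k1 hB hU ib.
have [cX sB subB mB pB] := hB; have [Um _ _] := hU.
have [b0 _ _ _] := UP 0 (leq0n _).
pose w := [seq (block B i.+1, U i.+1) | i <- iota 0 b].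
have sw : size w = b by rewrite size_map size_iota.
have nw i : i < b -> nth (set0, U 0) w i = (block B i.+1, U i.+1).
  by move=> ib; rewrite (nth_map 0) ?size_iota // nth_iota.
have bw : blocks w = B.
  apply: (@eq_from_nth _ set0); rewrite size_map sw // => i ib.
  by rewrite (nth_map (set0, U 0)) ?sw // nw.
have lw : links (U 0) w = [seq U i | i <- iota 0 b.+1].
  by rewrite /links /w -map_comp /= (iotaDl 1 0) -map_comp.
have lastw : last_link (U 0) w = U b.
  by rewrite last_linkE (last_nth (set0, U 0)) sw -{1}(prednK b0) /= nw ?prednK.
(* Disjoint sets of positive size are distinct; applied to the two end indices, this yields
   [exp_neq]. *)
have Uneq (i j : 'I_b.+1) : i \in J -> j \in J -> i != j -> U i != U j.
  move=> iJ jJ ij; have := dJ i j iJ jJ ij.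
  apply: contraTneq => ->; rewrite -setI_eq0 setIid -cards_eq0.
  have [_ -> _ _] := UP j (ltn_ord j).
  lia.
exists w, (U 0), [set U i | i : 'I_b.+1 in J]; split=> //.
split.
- rewrite /walk; have [_ -> _ _] := UP 0 (leq0n _); rewrite eqxx /=.
  apply/andP; split.
    apply/allP => p /mapP[i]; rewrite mem_iota /= add0n => ib ->.
    have [_ cU sU _] := UP i.+1 ib.
    have [_ cBi] : block B i.+1 \subset X /\ #|block B i.+1| = k.
      by apply: subB; rewrite mem_nth // sB.
    by rewrite /step_wf /= cBi cU !eqxx sU.
  apply/(pathP (set0, U 0)) => i; rewrite sw => ib.
  have [_ _ _ sU] := UP i (ltnW ib).
  have [_ cBi] : block B i.+1 \subset X /\ #|block B i.+1| = k.
    by apply: subB; rewrite mem_nth // sB.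
  rewrite nw // /link /=; case: i ib sU cBi => [|i] ib sU cBi /=.
    rewrite sU //; apply: contraTneq k1 => e.
    by rewrite -cBi -e cards0.
  rewrite nw ?(ltnW ib) //= sU //.
  have := mB i.+1 ib; apply: contra_eqN => /eqP ->.
  by rewrite setIid cBi; lia.
- by rewrite bw => D /subB[].
- by rewrite bw.
- rewrite /partition cover_imset cJ eqxx /=; apply/andP; split.
    apply/trivIsetP => _ _ /imsetP[i iJ ->] /imsetP[j jJ ->] Uij.
    by apply: dJ => //; apply: contraNneq Uij => ->.
  apply/negP => /imsetP[i _ e].
  by have [_] := UP i (ltn_ord i); rewrite -e cards0; lia.
- move=> _ /imsetP[i _ ->]; rewrite lw; apply: map_f.
  by rewrite mem_iota /= add0n.
- by apply/imsetP; exists ord0.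
- by rewrite lastw; apply/imsetP; exists ord_max.
- rewrite lastw; apply: (Uneq ord0 ord_max) => //.
  by rewrite -val_eqE /= eq_sym -lt0n.
Qed.

(** A class may occur several times in [s], so one index has to be chosen for each. The first
    occurrence serves, which gives [ord0] to the first entry; only the class equal to the last entry
    is sent to [ord_max] instead. The two rules do not clash because the first and last entries
    differ. *)
Lemma expansion_of_partition (T : finType) (b : nat) (s : seq {set T})
    (P : {set {set T}}) :
    size s = b.+1 -> {subset P <= s} ->
    nth set0 s 0 \in P -> nth set0 s b \in P -> nth set0 s 0 != nth set0 s b ->
  exists J : {set 'I_b.+1},
    [/\ ord0 \in J, ord_max \in J,
        {in J &, injective (fun i : 'I_b.+1 => nth set0 s i)}
      & [set nth set0 s i | i : 'I_b.+1 in J] = P].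
Proof.
move=> ss sP P0 Pb n0b.
have ilt A : A \in P -> index A s < b.+1 by move=> /sP; rewrite -index_mem ss.
pose f A : 'I_b.+1 := if A == nth set0 s b then ord_max else inord (index A s).
have fK : {in P, cancel f (fun i : 'I_b.+1 => nth set0 s i)}.
  move=> A PA; rewrite /f; case: eqP => [-> //|_].
  by rewrite inordK ?ilt // nth_index ?sP.
exists (f @: P); split.
- apply/imsetP; exists (nth set0 s 0) => //; rewrite /f (negPf n0b).
  apply: val_inj; rewrite /= inordK ?ilt //.
  by case: s {ilt f fK sP P0 Pb n0b} ss => //= a s _; rewrite eqxx.
- by apply/imsetP; exists (nth set0 s b) => //; rewrite /f eqxx.
- by move=> _ _ /imsetP[A PA ->] /imsetP[C PC ->] /=; rewrite !fK // => ->.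
- by rewrite -imset_comp; apply: etrans (imset_id P); apply: eq_in_imset.
Qed.

Lemma is_expansion_set_of_walk (T : finType) (X : {set T}) (k b : nat) w V
    (P : {set {set T}}) : 1 < k -> 0 < b ->
    walk k V w -> size w = b -> partition P X ->
    {subset P <= links V w} -> V \in P -> last_link V w \in P ->
    V != last_link V w ->
  exists J : {set 'I_b.+1},
    is_expansion_set X #|X| k (blocks w) (nth set0 (links V w)) J
    /\ (ord0 \in J /\ ord_max \in J).
Proof.
move=> k1 b0 wkw sw partP sP VP LP VL.
have Lb : nth set0 (links V w) b = last_link V w.
  by rewrite /last_link (last_nth set0) size_map sw.
have [||||J [J0 Jm injJ JP]] := @expansion_of_partition T b (links V w) P _ sP.
- by rewrite /= size_map sw.
- by [].
- by rewrite Lb.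
- by rewrite Lb.
have cP : {in P, forall A : {set T}, #|A| = k.-1}.
  by move=> A /sP; apply: walk_card wkw.
have [cV wfw pw] := and3P wkw.
have cX := card_uniform_partition cP partP.
exists J; split=> //; split.
- split.
  + by move=> i ib; have [|_ ->] := walk_meet (i := i) wkw; first by rewrite sw.
  + split; last exact/eqP.
    (* The link from the fictitious pair [(set0, V)] says that [V] is contained in the first
       block. *)
    by case: w sw pw {wkw sP LP VL Lb injJ JP wfw} => [|p w] /= bw;
      [lia|rewrite /block /link /= => /andP[/andP[]]].
  + have [b' e] : exists b', b = b'.+1 by exists b.-1; lia.
    have bw : b' < size w by rewrite sw e.
    have [e1 e2 _] := walk_nthE V bw.
    rewrite e e1 e2.
    by have /and3P[_ /eqP cp sp] := allP wfw _ (mem_nth (set0, V) bw).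
- split; first by rewrite cX dvdn_mull.
  by rewrite cX mulnK -?JP ?card_in_imset //; lia.
- move=> i j iJ jJ ij; apply: (trivIsetP (partition_trivIset partP)).
  + by rewrite -JP; apply/imsetP; exists i.
  + by rewrite -JP; apply/imsetP; exists j.
  + by apply: contraNneq ij => /injJ -> //.
- by rewrite -cover_imset JP (cover_partition partP).
Qed.

(** * Relabelling points by permutations *)

Lemma perm_onto (T : finType) (X A S : {set T}) :
    A \subset X -> S \subset X -> #|A| = #|S| ->
  exists s : {perm T}, s @: X = X /\ s @: A = S.
Proof.
move: {2}#|A :\: S| (leqnn #|A :\: S|) => n.
elim: n A => [|n IH] A nA sA sS cA.
  exists 1%g; rewrite !(eq_imset _ (perm1 (T := T))) !imset_id; split=> //.
  apply/eqP; rewrite eqEcard cA leqnn andbT -setD_eq0 -cards_eq0.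
  by rewrite -leqn0.
have [AS0|/set0Pn[a]] := eqVneq (A :\: S) set0.
  by apply: IH => //; rewrite AS0 cards0.
rewrite inE => /andP[aS aA].
(* By equality of sizes [S :\: A] is nonempty as well. Exchanging [a] with a point [c] of it
   preserves [X] and brings [A] one point closer to [S], which drives the induction. *)
have /set0Pn[c] : S :\: A != set0.
  rewrite setD_eq0; apply: contraNN aS => SA.
  by have /eqP -> : S == A by rewrite eqEcard SA cA leqnn.
rewrite inE => /andP[cNA cS].
have tX : tperm a c @: X = X.
  apply: im_perm_on; apply: subset_trans (tperm_on a c) _.
  by rewrite subUset !sub1set (subsetP sA) ?(subsetP sS).
have [||||s [sX sAS]] := IH (tperm a c @: A).
- rewrite -ltnS; apply: leq_trans nA; apply: (@leq_ltn_trans #|(A :\: S) :\ a|).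
    apply/subset_leq_card/subsetP => _ /setDP[/imsetP[x xA ->]].
    case: tpermP => [_|xc|/eqP xa _ xS]; rewrite ?cS //.
      by rewrite -xc xA in cNA.
    by rewrite !inE xa xS.
  by rewrite [X in _ < X](cardsD1 a) inE aS aA.
- by rewrite -tX imsetS.
- by [].
- by rewrite card_imset //; apply: perm_inj.
exists (tperm a c * s)%g.
have sE (Y : {set T}) : (tperm a c * s)%g @: Y = s @: (tperm a c @: Y).
  by rewrite -imset_comp; apply: eq_imset => x; rewrite permM.
by rewrite !sE tX sX sAS.
Qed.

Lemma expandable_perm (T : finType) (s : {perm T}) (X : {set T}) k w V P :
    expandable k X w V P ->
  expandable k (s @: X)
    [seq (s @: p.1, s @: p.2) | p : {set T} * {set T} <- w] (s @: V)
    [set s @: (A : {set T}) | A in P].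
Proof.
case=> wkw sX cX pX lP VP LP VL.
pose h (p : {set T} * {set T}) := (s @: p.1, s @: p.2).
have hw : blocks [seq h p | p <- w] = [seq s @: (D : {set T}) | D <- blocks w].
  by rewrite /blocks -!map_comp.
have hl : links (s @: V) [seq h p | p <- w]
        = [seq s @: (A : {set T}) | A <- links V w].
  by rewrite /links /= -!map_comp.
have hL : last_link (s @: V) [seq h p | p <- w] = s @: last_link V w.
  by rewrite /last_link -(last_map (fun A : {set T} => s @: A)) -!map_comp.
have sinj : injective (fun A : {set T} => s @: A).
  by apply: imset_inj; apply: perm_inj.
have cs (A : {set T}) : #|s @: A| = #|A|.
  by rewrite card_imset //; apply: perm_inj.
split.
- case/and3P: wkw => cV wfw pw; rewrite /walk cs cV /=; apply/andP; split.
    rewrite all_map; apply: sub_all wfw => p /and3P[c1 c2 sp].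
    by rewrite /step_wf /= !cs c1 c2 imsetS.
  have -> : (set0, s @: V) = h (set0, V) by rewrite /h /= imset0.
  rewrite path_map; apply: sub_path pw => p q /andP[pq npq].
  by rewrite /link /= imsetS //= (inj_eq sinj).
- by move=> D; rewrite hw => /mapP[C /sX CX ->]; apply: imsetS.
- move=> _ _ /imsetP[x xX ->] /imsetP[y yX ->] sxy.
  have [|D Dw /andP[xD yD]] := cX x y xX yX.
    by apply: contraNneq sxy => ->.
  by exists (s @: D); rewrite ?hw ?map_f // !imset_f.
- by rewrite imset_partition //; apply: perm_inj.
- by move=> _ /imsetP[A AP ->]; rewrite hl map_f // lP.
- exact: imset_f.
- by rewrite hL imset_f.
- by rewrite hL (inj_eq sinj).
Qed.

(** * Amalgamating two expandable walks along a common unchanged subset *)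

Section Amalgam.
Variables (T : finType) (k : nat) (X X' V S : {set T}).
Variables (w w' : seq ({set T} * {set T})) (P P' : {set {set T}}).
Hypothesis k1 : 1 < k.
Hypotheses (expw : expandable k X w V P) (expw' : expandable k X' w' S P').
Hypotheses (XX' : X :&: X' = S) (lastw : last_link V w = S).

Let L := last_link S w'.
Let k0 : 0 < k.-1. Proof. by rewrite -ltnS prednK // ltnW. Qed.
Let kS : k.-1.+1 = k. Proof. by rewrite prednK // ltnW. Qed.

Lemma expandable_card Y u A Q (B : {set T}) :
  expandable k Y u A Q -> B \in Q -> #|B| = k.-1.
Proof. by case=> wku _ _ _ uQ _ _ _ /uQ; apply: walk_card wku. Qed.

Lemma expandable_subset Y u A Q (B : {set T}) :
  expandable k Y u A Q -> B \in Q -> B \subset Y.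
Proof.
by case=> _ _ _ pQ _ _ _ _ BQ; rewrite -(cover_partition pQ) bigcup_sup.
Qed.

Lemma expandable_disjoint Y u A Q (B C : {set T}) : expandable k Y u A Q ->
  B \in Q -> C \in Q -> B != C -> [disjoint B & C].
Proof.
by case=> _ _ _ pQ _ _ _ _; apply: (trivIsetP (partition_trivIset pQ)).
Qed.

Let PS : S \in P. Proof. by rewrite -lastw; case: expw. Qed.
Let PS' : S \in P'. Proof. by case: expw'. Qed.
Let PL : L \in P'. Proof. by case: expw'. Qed.
Let SL : S != L. Proof. by case: expw'. Qed.
Let PV : V \in P. Proof. by case: expw. Qed.
Let VS : V != S. Proof. by rewrite -lastw; case: expw. Qed.

(** A class of [P] and a class of [P'] can meet only inside [X :&: X' = S]. As [S] belongs to both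
    partitions, every class other than [S] avoids it, so different classes never meet. *)
Lemma amalgam_partition : partition (P :|: P') (X :|: X').
Proof.
have [_ _ _ pP _ _ _ _] := expw; have [_ _ _ pP' _ _ _ _] := expw'.
apply/and3P; split.
- by rewrite /cover bigcup_setU -/(cover P) -/(cover P')
    (cover_partition pP) (cover_partition pP').
- have dis A B : A \in P -> B \in P' -> A != B -> [disjoint A & B].
    move=> AP BP' AB.
    have sAB : A :&: B \subset S.
      by rewrite -XX' setISS ?(expandable_subset expw)
        ?(expandable_subset expw').
    have [AS|AS] := eqVneq A S.
      by apply: (expandable_disjoint expw') => //; rewrite AS.
    rewrite -setI_eq0 -subset0
      -(disjoint_setI0 (expandable_disjoint expw AP PS AS)).
    by rewrite subsetI subsetIl.
  apply/trivIsetP => A B; rewrite !inE => /orP[AP|AP] /orP[BP|BP] AB.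
  + exact: (expandable_disjoint expw).
  + exact: dis.
  + by rewrite disjoint_sym dis // eq_sym.
  + exact: (expandable_disjoint expw').
- by rewrite inE negb_or; case/and3P: pP => _ _ ->; case/and3P: pP' => _ _ ->.
Qed.

(** Only the junction needs an argument: the blocks on its two sides differ, since a common block
    would lie in [X :&: X' = S], which has only [k.-1] points. *)
Lemma amalgam_cat : walk k V (w ++ w') /\ last_link V (w ++ w') = L.
Proof.
have [/and3P[cV wfw pw] sX _ _ _ _ _ _] := expw.
have [/and3P[cS wfw' pw'] sX' _ _ _ _ _ _] := expw'.
have lw : (last (set0, V) w).2 = S by rewrite -last_linkE.
have w'0 : w' != [::] by apply: contraNneq SL; rewrite /L => ->.
split; last first.
  rewrite /L !last_linkE last_cat.
  by case: (w') w'0.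
rewrite /walk cV all_cat wfw wfw' cat_path pw /=.
case: (w') w'0 pw' sX' wfw' => // q u _ /= /andP[/andP[/= Sq _] ->] sX'.
case/andP=> /and3P[/eqP cq _ _] _; rewrite /link lw Sq !andbT /=.
have qX' : q.1 \subset X' by apply: sX'; rewrite inE eqxx.
have := mem_last (set0, V) w; rewrite inE => /predU1P[->|].
  by apply: contraTneq k1 => /= q0; rewrite -cq -q0 cards0.
move/(map_f fst)/sX => lX; apply: contraTneq k1 => e.
have : q.1 \subset S by rewrite -XX' subsetI -{1}e lX.
by move/subset_leq_card; rewrite cq (eqP cS) -{1}kS ltnn.
Qed.

(* Each pair in [joining] is a new block [q.2 |: q.1], to be inserted where
   the unchanged subset is [q.1]. *)
Definition joining := setX (P :\ S) (X' :\: S).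

Lemma joiningP q : q \in joining ->
  [/\ q.1 \in P, q.1 != S, q.2 \in X' & q.2 \notin X].
Proof.
case: q => A y; rewrite !inE -{2}XX' inE => /andP[/andP[-> ->] /andP[]].
by move=> yS yX'; rewrite yX' andbT in yS *.
Qed.

(** Both components can be read off from the block [y |: A]: its trace on [X] is [A], and what
    remains outside [X] is the point [y]. *)
Lemma joining_inj :
  {in joining &, injective (fun q : {set T} * T => q.2 |: q.1)}.
Proof.
move=> [A y] [B z] /joiningP[/= AP _ _ yX] /joiningP[/= BP _ _ zX] /= e.
have mX C u : C \in P -> u \notin X ->
    (u |: C) :&: X = C /\ (u |: C) :\: X = [set u].
  move=> /(expandable_subset expw) CX uX; split; apply/setP => x; rewrite !inE.
    have [->|_] /= := eqVneq x u; last first.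
      by case: (boolP (x \in C)) => // /(subsetP CX).
    by rewrite (negPf uX); apply/esym; apply: contraNF uX; apply: (subsetP CX).
  have [->|_] /= := eqVneq x u; first by rewrite uX.
  by case: (boolP (x \in C)) => [/(subsetP CX) -> |]; rewrite ?andbF.
have [eA ey] := mX A y AP yX; have [eB ez] := mX B z BP zX.
by congr (_, _); [rewrite -eA -eB e | apply: set1_inj; rewrite -ey -ez e].
Qed.

Lemma joining_card q : q \in joining -> #|q.2 |: q.1| = k.
Proof.
case/joiningP=> AP _ _ yX; rewrite cardsU1 (expandable_card expw AP).
rewrite (contraNN _ yX) /= ?add1n ?kS //.
exact/subsetP/(expandable_subset expw).
Qed.

(** The point [q.2] keeps the block out of the first design. A block of the second design would
    force [q.1] into [X :&: X' = S], but [q.1] is nonempty and disjoint from [S]. *)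
Lemma joining_new q : q \in joining -> q.2 |: q.1 \notin blocks (w ++ w').
Proof.
case/joiningP=> AP AS yX' yX; rewrite /blocks map_cat mem_cat negb_or.
have [_ sX _ _ _ _ _ _] := expw; have [_ sX' _ _ _ _ _ _] := expw'.
apply/andP; split; apply/negP.
  by move/sX; rewrite subUset sub1set (negPf yX).
move/sX'; rewrite subUset => /andP[_ AX'].
have : q.1 \subset S by rewrite -XX' subsetI AX' (expandable_subset expw AP).
have /disjoint_setI0 AS0 := expandable_disjoint expw AP PS AS.
move/setIidPl; rewrite AS0 => e; have := expandable_card expw AP.
by rewrite -e cards0 => e0; have := k0; rewrite -e0.
Qed.

(** The prefix is kept explicit because it makes the result disjoint-capable, and [w0 != [::]]
    supplies a block after it. The size counts one new block for each pair in [joining]. *)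
Lemma amalgam_exists : exists w0,
  let W := [seq (y |: V, V) | y <- enum L] ++ w0 in
  [/\ expandable k (X :|: X') W V (P :|: P'), last_link V W = L, w0 != [::]
    & size W = size w + size w' + (#|P|.-1 * #|X' :\: S|)].
Proof.
have [wkc Lc] := amalgam_cat.
(* Otherwise [V] would lie in both [X] and [X'], hence in [S], from which it is disjoint. *)
have VL : V != L.
  apply/eqP => e; have sVS : V \subset S.
    by rewrite -XX' subsetI (expandable_subset expw PV) e
      (expandable_subset expw' PL).
  have := expandable_card expw PV; rewrite -(setIidPl sVS).
  rewrite (disjoint_setI0 (expandable_disjoint expw PV PS VS)) cards0 => e0.
  by have := k0; rewrite -e0.
have LS : [disjoint L & S].
  by apply: (expandable_disjoint expw') => //; rewrite eq_sym.
(* The blocks of the prefix are themselves joining blocks: moving them to the front fixes their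
   position without adding to the count. The remaining ones form [Ds] and are inserted wherever
   their unchanged subset occurs. *)
have sLj : setX [set V] L \subset joining.
  apply: setXS; first by rewrite sub1set !inE VS PV.
  by rewrite subsetD LS (expandable_subset expw' PL).
pose f (q : {set T} * T) := q.2 |: q.1.
pose Ds := [seq f q | q <- enum (joining :\: setX [set V] L)].
pose Ds0 := [seq y |: V | y <- enum L].
have Pc : {subset P :|: P' <= links V (w ++ w')}.
  have [_ _ _ _ sP _ _ _] := expw; have [_ _ _ _ sP' _ _ _] := expw'.
  move=> A; rewrite /links map_cat -cat_cons mem_cat => /setUP[/sP -> //|/sP'].
  rewrite inE => /predU1P[->|->]; last by rewrite orbT.
  by rewrite sP.
have inDs D : D \in Ds -> exists2 q, q \in joining :\: setX [set V] L & D = f q.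
  by case/mapP=> q; rewrite mem_enum => qj ->; exists q.
have inDs0 D : D \in Ds0 -> exists2 y, y \in L & D = y |: V.
  by case/mapP=> y; rewrite mem_enum => yL ->; exists y.
have Lj y : y \in L -> (V, y) \in joining.
  by move=> yL; rewrite (subsetP sLj) // in_setX set11.
have [||D /inDs[q /setDP[qj _] ->]|D /inDs[q /setDP[qj _] ->]|] :=
    @walk_inserts _ k V (w ++ w') Ds k1.
- exact: wkc.
- rewrite map_inj_in_uniq ?enum_uniq // => p q.
  rewrite !mem_enum => /setDP[pj _] /setDP[qj _]; exact: joining_inj.
- exact: joining_new.
- split; first exact: joining_card.
  exists q.1; last exact: subsetUr.
  by have [qP _ _ _] := joiningP qj; rewrite Pc // inE qP.
move=> w0 [wk0 pe0 s0 l0]; exists w0 => W.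
have bW : blocks W = Ds0 ++ blocks w0.
  by rewrite /blocks map_cat -map_comp.
have wkW : walk k V W.
  have eW : W = [seq (D, V) | D <- Ds0] ++ w0 by rewrite -map_comp.
  rewrite eW; apply: walk_prefix => //.
  - rewrite map_inj_in_uniq ?enum_uniq // => y z; rewrite !mem_enum => yL zL e.
    by have [] := @joining_inj (V, y) (V, z) (Lj y yL) (Lj z zL) e.
  - move=> _ /inDs0[y yL ->]; rewrite (perm_mem pe0) mem_cat negb_or.
    rewrite (joining_new (Lj y yL)) andbT.
    apply/negP => /inDs[q /setDP[qj qL] /(joining_inj (Lj y yL) qj) e].
    by rewrite -e in_setX set11 yL in qL.
  - move=> _ /inDs0[y yL ->]; split; last exact: subsetUr.
    exact: (joining_card (Lj y yL)).
have memW D : D \in blocks W =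
    [|| D \in Ds0, D \in Ds, D \in blocks w | D \in blocks w'].
  by rewrite bW mem_cat (perm_mem pe0) /blocks map_cat !mem_cat.
have jW q : q \in joining -> f q \in blocks W.
  move=> qj; rewrite memW.
  have [qL|qL] := boolP (q \in setX [set V] L).
    case: q qL {qj} => A y; rewrite in_setX in_set1 => /andP[/= /eqP -> yL].
    have -> // : f (V, y) \in Ds0 by apply/mapP; exists y; rewrite ?mem_enum.
  have -> : f q \in Ds by apply: map_f; rewrite mem_enum in_setD qL.
  by rewrite orbT.
have lW : last_link V W = L.
  rewrite -Lc -l0 !last_linkE last_cat; case: (w0) => //=.
  by case: (enum L) => //= y l; rewrite last_map.
have w00 : w0 != [::].
  by apply: contraNneq VL => w0n; rewrite -Lc -l0 w0n.
split=> //; last first.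
  rewrite -[size W](size_map fst) -/(blocks W) bW size_cat (perm_size pe0).
  rewrite size_cat !size_map -!cardE size_cat (cardsD joining) (setIidPr sLj)
    !cardsX cards1.
  have := subset_leq_card sLj; rewrite /joining !cardsX cards1.
  rewrite [#|P|](cardsD1 S) PS mul1n => leL.
  by rewrite addnA subnKC // addnC.
have [_ sX cX _ _ _ _ _] := expw; have [_ sX' cX' _ _ _ _ _] := expw'.
have sj q : q \in joining -> f q \subset X :|: X'.
  case/joiningP=> qP _ qX' _; rewrite subUset sub1set inE qX' orbT /=.
  by rewrite subsetU // (expandable_subset expw).
have cj x y : x \in X -> x \notin X' -> y \in X' -> y \notin X ->
    exists2 D, D \in blocks W & (x \in D) && (y \in D).
  have [_ _ _ pP _ _ _ _] := expw.
  move=> xX xX' yX' yX; have xc : x \in cover P by rewrite (cover_partition pP).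
  (* The class of [P] through [x] is not [S], as [x] lies outside [X']; joined with [y] it is
     therefore one of the new blocks. *)
  exists (f (pblock P x, y)); last by rewrite /f !inE eqxx mem_pblock xc orbT.
  apply: jW; rewrite !inE yX' pblock_mem // -XX' inE (negPf yX) /= !andbT.
  apply: contraNneq xX' => e; have := mem_pblock P x.
  by rewrite e xc => /setIP[].
split=> //.
- move=> D; rewrite memW => /or4P[/inDs0[y yL ->]|/inDs[q /setDP[qj _] ->]||].
  + exact: (sj _ (Lj y yL)).
  + exact: sj.
  + by move/sX => DX; apply: subset_trans DX (subsetUl _ _).
  + by move/sX' => DX; apply: subset_trans DX (subsetUr _ _).
- move=> x y xU yU xy.
  have [xX|xX] := boolP (x \in X); have [yX|yX] := boolP (y \in X).
  + have [D Dw Dxy] := cX x y xX yX xy.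
    by exists D => //; rewrite memW Dw !orbT.
  + have yX' : y \in X' by move: yU; rewrite inE (negPf yX).
    have [xX'|xX'] := boolP (x \in X'); last exact: cj.
    have [D Dw Dxy] := cX' x y xX' yX' xy.
    by exists D => //; rewrite memW Dw !orbT.
  + have xX' : x \in X' by move: xU; rewrite inE (negPf xX).
    have [yX'|yX'] := boolP (y \in X'); last first.
      by have [D ? ?] := cj y x yX yX' xX' xX; exists D => //; rewrite andbC.
    have [D Dw Dxy] := cX' x y xX' yX' xy.
    by exists D => //; rewrite memW Dw !orbT.
  + move: xU yU; rewrite !inE (negPf xX) (negPf yX) /= => xX' yX'.
    have [D Dw Dxy] := cX' x y xX' yX' xy.
    by exists D => //; rewrite memW Dw !orbT.
- exact: amalgam_partition.
- move=> A /Pc/s0; rewrite /links /W map_cat inE => /predU1P[->|Aw].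
    exact: mem_head.
  by rewrite inE mem_cat Aw !orbT.
- by rewrite inE PV.
- by rewrite lW inE PL orbT.
- by rewrite lW.
Qed.
End Amalgam.

(** * Disjoint capability from the blocks at the front *)

Lemma disjoint_capable_prefix (T : finType) k (V L : {set T}) w0 :
    1 < k -> #|L| = k.-1 -> [disjoint L & V] -> w0 != [::] ->
    let W := [seq (y |: V, V) | y <- enum L] ++ w0 in
    walk k V W ->
  [/\ k <= size W, forall i, i <= k.-1 -> nth set0 (links V W) i = V
    & L = \bigcup_(1 <= i < k) (block (blocks W) i :\: block (blocks W) i.+1)].
Proof.
move=> k1 cL LV w00 W wkW.
have kS : k.-1.+1 = k by rewrite prednK // ltnW.
have sL : size (enum L) = k.-1 by rewrite -cardE.
have sW : k <= size W.
  rewrite size_cat size_map sL -{1}kS -addn1 leq_add2l lt0n size_eq0.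
  exact: w00.
have [y0 _] : exists y0, y0 \in L.
  by apply/set0Pn; rewrite -cards_eq0 cL -lt0n -ltnS kS.
have nW i : i < k.-1 ->
    nth (set0, V) W i = (nth y0 (enum L) i |: V, V).
  by move=> ik; rewrite nth_cat size_map sL ik (nth_map y0) // sL.
have lW i : i <= k.-1 -> nth set0 (links V W) i = V.
  case: i => [//|i] ik; have iW : i < size W.
    by apply: leq_trans sW; rewrite -kS ltnS ltnW.
  by have [_ -> _] := walk_nthE V iW; rewrite nW.
split=> //.
transitivity (\bigcup_(y in L) [set y]).
  apply/setP => x; apply/idP/bigcupP => [xL|[y yL /set1P -> //]].
  by exists x; rewrite ?set11.
rewrite -big_enum (big_nth y0) sL -[in RHS]kS big_add1 /=.
(* The unchanged subset after the block [y |: V] is [V], so the points it discards are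
   [(y |: V) :\: V], that is [y] alone. For the last block of the prefix the successor is the head
   of [w0]. *)
apply: eq_big_nat => i /andP[_ ik].
have iW : i < size W by apply: leq_trans sW; rewrite -kS ltnS ltnW.
have [|_ mW] := walk_meet (i := i.+1) wkW.
  by apply: leq_trans sW; rewrite -kS ltnS.
have [bW _ _] := walk_nthE V iW.
have -> (A B : {set T}) : A :\: B = A :\: (A :&: B).
  by rewrite setDIr setDv set0U.
rewrite -mW lW // bW nW //=; apply/setP => x; rewrite !inE.
have [->|_] := eqVneq x (nth y0 (enum L) i).
  have yL : nth y0 (enum L) i \in L by rewrite -mem_enum mem_nth // sL.
  by rewrite (disjointFr LV yL).
by rewrite orFb andNb.
Qed.

(** * Additivity of the excess *)

Lemma bin2D m n : 'C(m + n, 2) = 'C(m, 2) + 'C(n, 2) + m * n.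
Proof.
elim: n => [|n IH]; first by rewrite !addn0 muln0 addn0.
by rewrite addnS !binS !bin1 IH mulnS; lia.
Qed.

(** With [s] standing for [k.-1], the [p * (v' - s)] joining blocks contribute [s] each, which
    matches the [p * s] times [v' - s] pairs between the two designs outside the common [s]-set. The
    pairs inside that set are counted for both designs, and this absorbs the second term
    ['C(s, 2)]. *)
Lemma excess_amalgam s p v v' b b' : s <= v' -> v = p.+1 * s ->
  excess (v + v' - s) s.+1 (b + b' + p * (v' - s))
  = (excess v s.+1 b + excess v' s.+1 b')%R.
Proof.
move=> sv' ->; have -> : v' = v' - s + s by rewrite subnK.
move: (v' - s) => c; rewrite /excess /= addnA !addnK mulSn !bin2D.
move: 'C(s, 2) 'C(c, 2) 'C(p * s, 2) => x y z; nia.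
Qed.

(** * Parameters and properties of the amalgamated design *)

Theorem theorem5 (T : finType) (X X' : {set T}) (k v v' b b' : nat)
    (e e' : int)
    (hk : 1 < k)
    (hX : exists (B : seq {set T}) (U : nat -> {set T}) (J : {set 'I_b.+1}),
        [/\ is_sccd X v k b B,
            excess v k b = e,
            is_expansion_set X v k B U J,
            is_outer J
          & ord0 \in J /\ ord_max \in J])
    (hX' : exists (B' : seq {set T}) (U' : nat -> {set T})
                  (J' : {set 'I_b'.+1}),
        [/\ is_sccd X' v' k b' B',
            excess v' k b' = e',
            is_expansion_set X' v' k B' U' J',
            is_outer J'
          & ord0 \in J' /\ ord_max \in J'])
    (hXX' : #|X :&: X'| = k.-1) :
  let vs := v + v' - k + 1 in
  let bs := b + b' + ((v' - k + 1) * (v - k + 1)) %/ k.-1 in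
  let Xs := X :|: X' in
  exists (B : seq {set T}) (U : nat -> {set T}) (J : {set 'I_bs.+1}),
    [/\ is_sccd Xs vs k bs B,
        excess vs k bs = (e + e')%R,
        is_expansion_set Xs vs k B U J,
        is_outer J
      & disjoint_capable k B U J].
Proof.
move=> vs bs Xs.
have [B [U [J [hB <- hJ _ [J0 Jm]]]]] := hX.
have [B' [U' [J' [hB' <- hJ' _ [J0' Jm']]]]] := hX'.
have [w [V [P [ew sw]]]] := expandable_of_sccd hk hB hJ J0 Jm.
have [w' [V' [P' [ew' sw']]]] := expandable_of_sccd hk hB' hJ' J0' Jm'.
have kS : k.-1.+1 = k by rewrite prednK // ltnW.
have [s [sX sL]] : exists s : {perm T},
    s @: X = X /\ s @: last_link V w = X :&: X'.
  have LP := exp_last ew; apply: perm_onto (subsetIl _ _) _.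
    exact: expandable_subset ew LP.
  by rewrite hXX' (expandable_card ew LP).
have [s' [sX' sV']] : exists s : {perm T}, s @: X' = X' /\ s @: V' = X :&: X'.
  have VP := exp_first ew'; apply: perm_onto (subsetIr _ _) _.
    exact: expandable_subset ew' VP.
  by rewrite hXX' (expandable_card ew' VP).
have := expandable_perm s ew; have := expandable_perm s' ew'.
rewrite sX sX' sV'.
set w1' := map _ w'; set P1' := imset _ (mem P').
set w1 := map _ w; set P1 := imset _ (mem P).
move=> e1' e1.
have l1 : last_link (s @: V) w1 = X :&: X'.
  rewrite -sL /last_link -(last_map (fun A : {set T} => s @: A)) -!map_comp.
  by [].
have [w0 [eW lW w00 sW]] := amalgam_exists hk e1 e1' erefl l1.
set W := _ ++ w0 in eW lW sW; set L := last_link _ w1' in W eW lW sW.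
have LP : L \in P1' := exp_last e1'.
have card_part Y (u : seq ({set T} * {set T})) A Q : expandable k Y u A Q ->
    #|Y| = #|Q| * k.-1 /\ 1 < #|Q|.
  move=> eu; have cQ : {in Q, forall C : {set T}, #|C| = k.-1}.
    by move=> C; apply: expandable_card eu.
  split; first exact: card_uniform_partition cQ (exp_part eu).
  apply/card_gt1P; exists A, (last_link A u).
  by split; [exact: exp_first eu | exact: exp_last eu | exact: exp_neq eu].
have [cX P2] := card_part _ _ _ _ e1.
have [cX' P2'] := card_part _ _ _ _ e1'.
have [vX _ _ _ _] := hB; have [vX' _ _ _ _] := hB'.
rewrite vX in cX; rewrite vX' in cX'.
(* Each partition has at least two classes of size [k.-1]; the resulting bounds make the truncated
   subtractions in [vs] and [bs] exact. *)
have kv' : k.-1 < v' by rewrite cX' -[X in X < _]mul1n ltn_pmul2r // -ltnS kS.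
have kv : k.-1 < v by rewrite cX -[X in X < _]mul1n ltn_pmul2r // -ltnS kS.
have vsE : vs = v + v' - k.-1 by rewrite /vs; lia.
have cXs : #|Xs| = vs by rewrite cardsU hXX' vX vX' vsE.
have cD : #|X' :\: (X :&: X')| = v' - k.-1.
  by rewrite cardsD vX' (setIidPr (subsetIr _ _)) hXX'.
have bsE : bs = b + b' + #|P1|.-1 * (v' - k.-1).
  rewrite /bs; have -> : v' - k + 1 = v' - k.-1 by lia.
  (* This is the number of points of [X] outside the common set, a multiple of [k.-1] because the
     other classes of [P1] partition them; hence the division in [bs] is exact. *)
  have -> : v - k + 1 = #|P1|.-1 * k.-1.
    by rewrite -subn1 mulnBl mul1n -cX; lia.
  by rewrite mulnA mulnK ?(mulnC (v' - _)) // -ltnS kS.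
have sWb : size W = bs by rewrite sW cD !size_map sw sw' bsE.
have b0 : 0 < bs.
  by rewrite -sWb size_cat addn_gt0
  (lt0n (size w0)) size_eq0 w00 orbT.
have [wkW sWX cW pW lPW VW LW VL] := eW.
have [J1 [hJ1 [J10 J1m]]] :=
  is_expansion_set_of_walk hk b0 wkW sWb pW lPW VW LW VL.
have LV : [disjoint L & s @: V].
  rewrite -lW disjoint_sym; exact: (expandable_disjoint eW).
have [kW UW LE] :=
  disjoint_capable_prefix hk (expandable_card e1' LP) LV w00 wkW.
exists (blocks W), (nth set0 (links (s @: V) W)), J1; split.
- split=> //; first by rewrite size_map.
  + move=> D DW; split; first exact: sWX.
    have /and3P[_ /allP wfW _] := wkW.
    by case/mapP: DW => p /wfW /and3P[/eqP cp _ _] ->.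
  + by move=> i ib; have [|] := walk_meet (i := i) wkW; first by rewrite sWb.
- rewrite vsE bsE -kS; apply: excess_amalgam; first exact: ltnW.
  by rewrite prednK // ltnW.
- by rewrite -cXs.
- by left.
- split=> //; first by rewrite -sWb.
  by rewrite -LE -lW /last_link (last_nth set0) size_map sWb.
Qed.
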